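(* Let $n\ge1$, let $\sigma\in S_n$, and let $\mathbf{i}=(i_1,i_2,\ldots,i_{n-1})$ be a sequence of distinct integers such that $|i_k|\in\{\sigma(1),\ldots,\sigma(k)\}$ for all $k\in\{1,\ldots,n-1\}$. For $J=J(\sigma,\mathbf{i})$ we have $$\langle\chi_J,\chi_n\rangle=(-1)^d\,\mathrm{sgn}(\sigma)\prod_{k\,:\,|i_k|=\sigma(k)}(n-k+1),\qquad d=\sum_{k\,:\,i_k<0}(n-k),$$ where $k$ ranges over $\{1,\dots,n-1\}$ in both the product and the sum.
   Context: For $1\le k<j\le n$ set $(i_k,\sigma(j))^+=(i_k,\sigma(j))$ if $i_k>0$ and $(i_k,\sigma(j))^+=(\sigma(j),-i_k)$ if $i_k<0$. The pattern $J(\sigma,\mathbf{i})$ is the set of positions $$J(\sigma,\mathbf{i})=\{(i_k,\sigma(j))^+:1\le k<j\le n\}$$ (it has exactly $n(n-1)/2$ elements). For a finite set $I$ of pairs of positive integers put $\chi_I=\prod_{(i,j)\in I}(x_i-x_j)$, and $\chi_n=\prod_{1\le i<j\le n}(x_i-x_j)$ (empty products are 1). $\langle\cdot,\cdot\rangle$ is the inner product on the real polynomial ring $\mathbf{R}[x_1,x_2,\dots]$ for which the monomials form an orthonormal basis. *)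

(* Defs.v *)
From mathcomp Require Export all_boot all_order all_algebra all_fingroup.
From mathcomp Require Export finmap.
From mathcomp Require Export monalg.
From mathcomp Require Export reals.

Set Implicit Arguments.
Unset Strict Implicit.
Unset Printing Implicit Defensive.

Import GRing.Theory Num.Theory.

Local Open Scope ring_scope.

(* Polynomials in countably many commuting variables; monomials are the       *)
(* finitely supported exponent functions on nat.  Only the variables of       *)
(* index >= 1 are ever used.                                                  *)
Notation polyInf R := {malg R[{cmonom nat}]}.

Definition xvar (R : realType) (i : nat) : polyInf R := << ucm i >>.

Definition inner (R : realType) (p q : polyInf R) : R :=
  \sum_(m <- msupp p) p@_m * q@_m.

Lemma inner_subset (R : realType) (p q : polyInf R) (A : {fset {cmonom nat}}) :
  (msupp p `<=` A)%fset -> inner p q = \sum_(m <- A) p@_m * q@_m.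
Proof.
move=> sA; apply: big_fset_incl => // m _ mp.
by rewrite mcoeff_outdom // mul0r.
Qed.

Lemma innerC (R : realType) (p q : polyInf R) : inner p q = inner q p.
Proof.
rewrite (inner_subset q (fsubsetUl (msupp p) (msupp q))).
rewrite (inner_subset p (fsubsetUr (msupp p) (msupp q))).
by apply: eq_bigr => m _; rewrite mulrC.
Qed.

Lemma inner_linearr (R : realType) (p : polyInf R) (a : R) (q1 q2 : polyInf R) :
  inner p (a *: q1 + q2) = a * inner p q1 + inner p q2.
Proof.
rewrite /inner mulr_sumr -big_split; apply: eq_bigr => m _ /=.
by rewrite mcoeffD mcoeffZ mulrDr mulrCA.
Qed.

Lemma inner_monom (R : realType) (m m' : {cmonom nat}) :
  inner (<< m >> : polyInf R) << m' >> = (m == m')%:R.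
Proof.
rewrite (inner_subset _ (@msuppU_le _ _ m 1)).
rewrite big_seq_fset1.
have E (k : {cmonom nat}) : (<< k >> : polyInf R)@_m = (k == m)%:R.
  exact: mcoeffU.
apply: (etrans (congr2 *%R (E m) (E m'))).
by rewrite eqxx mul1r eq_sym.
Qed.

Definition chi (R : realType) (I : {fset nat * nat}) : polyInf R :=
  \prod_(p <- I) (xvar R p.1 - xvar R p.2).

Definition chin (R : realType) (n : nat) : polyInf R :=
  \prod_(1 <= i < n.+1) \prod_(i.+1 <= j < n.+1) (xvar R i - xvar R j).

(* 'I_n is 0-based: the index j : 'I_n stands for j + 1, so that sval1 s j    *)
(* is the value in {1, ..., n} of the permutation at j + 1.                   *)
Definition sval1 (n : nat) (s : 'S_n) (j : 'I_n) : nat := (s j).+1.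

(* (a, b)^+ for a nonzero and b > 0; when a < 0, `|a|%N is -a.                *)
Definition pos_pair (a : int) (b : nat) : nat * nat :=
  if 0 < a then (`|a|%N, b) else (b, `|a|%N).

(* The k-th entry of i (0-based, k < n - 1) is the (k + 1)-st term i_{k+1}.   *)
Definition pattern (n : nat) (s : 'S_n) (i : n.-1.-tuple int) :
    {fset nat * nat} :=
  [fset pos_pair (tnth i u.1) (sval1 s u.2)
     | u in [pred u : 'I_n.-1 * 'I_n | (u.1 < u.2)%N]]%fset.

(* Main.v *)
(* Write L p for <p, chi_n>. Up to (-1)^d, chi_J is the product of the rows
   prod_(j > k) (x_|i_k| - x_s(j)), and L changes sign when two variables are
   exchanged. Trade the Vandermonde product V_k of x_s(k), ..., x_s(n) for row k
   times V_(k+1), one row at a time: if |i_k| = s(k) nothing changes, and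
   otherwise the value of L is divided by n - k + 1. The latter comes from the
   identity V(z) = sum_u V(z with z_u replaced by y) (Cramer's rule for the first
   row of the Vandermonde matrix), all of whose n - k + 1 terms have the same
   value under L because the earlier rows are symmetric in the variables of V_k.
   The process starts at L(V_1) = sgn(s) <chi_n, chi_n> = sgn(s) n! and
   n! = prod_(k < n) (n - k + 1). *)

From HB Require Import structures.
Require Import Defs.
From mathcomp Require Import zify.

Set Implicit Arguments.
Unset Strict Implicit.
Unset Printing Implicit Defensive.

Import GRing.Theory Num.Theory.

Local Open Scope ring_scope.

Definition vdm (A : comNzRingType) (n : nat) (z : 'I_n -> A) : A :=
  \prod_(i < n) \prod_(j < n | (i < j)%N) (z i - z j).

Lemma vdm_det (A : comNzRingType) (n : nat) (z : 'I_n -> A) :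
  vdm z = \det (Vandermonde n (\row_j - z j)).
Proof.
rewrite det_Vandermonde; apply: eq_bigr => i _; apply: eq_bigr => j _.
by rewrite !mxE opprK addrC.
Qed.

Lemma eq_vdm (A : comNzRingType) (n : nat) (z z' : 'I_n -> A) :
  z =1 z' -> vdm z = vdm z'.
Proof. by move=> e; do 2![apply: eq_bigr => ? _]; rewrite !e. Qed.

Lemma vdm_perm (A : comNzRingType) (n : nat) (z : 'I_n -> A) (s : 'S_n) :
  vdm (z \o s) = (-1) ^+ s * vdm z.
Proof.
rewrite !vdm_det -[odd_perm s]odd_permV -det_perm mulrC -det_mulmx -col_permE.
by congr (\det _); apply/matrixP => i j; rewrite !mxE.
Qed.

Lemma vdm_morph (A B : comNzRingType) (f : {rmorphism A -> B}) (n : nat)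
    (z : 'I_n -> A) : f (vdm z) = vdm (f \o z).
Proof.
rewrite rmorph_prod; apply: eq_bigr => i _; rewrite rmorph_prod.
by apply: eq_bigr => j _; rewrite rmorphB.
Qed.

Lemma vdm_recl (A : comNzRingType) (n : nat) (z : 'I_n.+1 -> A) :
  vdm z = \prod_(j < n) (z ord0 - z (lift ord0 j)) * vdm (z \o lift ord0).
Proof.
rewrite /vdm big_ord_recl; congr (_ * _).
  by rewrite big_mkcond big_ord_recl /= mul1r.
apply: eq_bigr => i _; rewrite big_mkcond big_ord_recl /= mul1r.
by rewrite [RHS]big_mkcond.
Qed.

Lemma vdm_sum_replace (A : comNzRingType) (n : nat) (z : 'I_n.+1 -> A) (y : A) :
  \sum_u vdm (fun i => if i == u then y else z i) = vdm z.
Proof.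
set V := Vandermonde n.+1 (\row_j - z j).
pose c : 'cV[A]_n.+1 := \col_i (- y) ^+ i.
have detE (u : 'I_n.+1) :
    vdm (fun i => if i == u then y else z i) = (\adj V *m c) u ord0.
  rewrite vdm_det (expand_det_col _ u) mxE; apply: eq_bigr => i _.
  rewrite !mxE eqxx mulrC; congr (_ * _); rewrite /cofactor; congr (_ * \det _).
  by apply/matrixP => k l; rewrite !mxE eq_sym (negPf (neq_lift _ _)).
have -> : vdm z = (V *m (\adj V *m c)) ord0 ord0.
  by rewrite mulmxA mul_mx_adj mul_scalar_mx !mxE expr0 mulr1 vdm_det.
by rewrite mxE; apply: eq_bigr => u _; rewrite detE [V _ _]mxE expr0 mul1r.
Qed.

(* By [vdm_sum_replace], [vdm z] is the sum over [u] of the products with [z u]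
   replaced by [y]; [tau u] turns the first of them into minus the [u]-th. *)
Lemma skew_replace_first (A : comNzRingType) (B : zmodType) (L : {additive A -> B})
    (n : nat) (z : 'I_n.+1 -> A) (tau : 'I_n.+1 -> {rmorphism A -> A}) (y T : A) :
  (forall u j, u != ord0 -> tau u (z j) = z (tperm ord0 u j)) ->
  (forall u p, u != ord0 -> L (tau u p) = - L p) ->
  (forall u, u != ord0 -> tau u y = y) ->
  (forall u, u != ord0 -> tau u T = T) ->
  L (T * (\prod_(j < n) (y - z (lift ord0 j)) * vdm (z \o lift ord0))) *+ n.+1
    = L (T * vdm z).
Proof.
move=> tauz Ltau tauy tauT; rewrite -[vdm z](vdm_sum_replace _ y).
rewrite mulr_sumr raddf_sum /=.
have const_sum (c : B) : c *+ n.+1 = \sum_(u < n.+1) c by rewrite sumr_const card_ord.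
rewrite const_sum; apply: eq_bigr => u _; pose w v i := if i == v then y else z i.
have -> : \prod_(j < n) (y - z (lift ord0 j)) * vdm (z \o lift ord0) = vdm (w ord0).
  by rewrite vdm_recl /w /=; congr (_ * _); apply: eq_bigr.
have [-> // | u0] := eqVneq u ord0.
apply: oppr_inj; rewrite -(Ltau u) // rmorphM tauT // vdm_morph.
have -> : vdm (tau u \o w ord0) = vdm (w u \o tperm ord0 u).
  apply: eq_vdm => i /=; rewrite /w.
  have -> : (tperm ord0 u i == u) = (i == ord0).
    by rewrite -[X in _ == X](tpermL ord0 u) (inj_eq perm_inj).
  by case: ifP => _; rewrite ?tauy ?tauz.
by rewrite vdm_perm odd_tperm eq_sym u0 expr1 mulN1r mulrN raddfN.
Qed.

Lemma skew_rows (A : comNzRingType) (B : zmodType) (L : {additive A -> B})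
    (n : nat) (z : 'I_n.+1 -> A) (tau : 'I_n.+1 -> 'I_n.+1 -> {rmorphism A -> A})
    (y : 'I_n -> A) (b : pred 'I_n) (T : A) :
  (forall u v j, tau u v (z j) = z (tperm u v j)) ->
  (forall u v p, u != v -> L (tau u v p) = - L p) ->
  (forall u v, tau u v T = T) ->
  (forall k : 'I_n,
     if b k then y k = z (widen_ord (leqnSn n) k)
     else (exists2 j : 'I_n.+1, (j < k)%N & y k = z j)
          \/ (forall u v, tau u v (y k) = y k)) ->
  L (T * \prod_(k < n) \prod_(j < n.+1 | (k < j)%N) (y k - z j))
     *+ \prod_(k < n | ~~ b k) (n.+1 - k) = L (T * vdm z).
Proof.
elim: n => [|n IHn] in z tau y b T *.
  move=> _ _ _ _; rewrite !big_ord0 mulr1n; congr (L (_ * _)); apply/esym.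
  by apply: big1 => i _; apply: big1 => j; rewrite !ord1.
move=> tauz Ltau tauT yP.
pose z' := z \o lift ord0; pose P := \prod_(j < n.+1) (y ord0 - z' j).
have y0fix (u v : 'I_n.+1) : tau (lift ord0 u) (lift ord0 v) (y ord0) = y ord0.
  move: (yP ord0); case: ifP => [_ -> | _ [[j //] | -> //]].
  by rewrite tauz tpermD //= -val_eqE.
have lift_tperm (u v j : 'I_n.+1) :
    tperm (lift ord0 u) (lift ord0 v) (lift ord0 j) = lift ord0 (tperm u v j).
  by rewrite -(inj_tperm _ _ _ (@lift_inj _ ord0)).
have Pfix u v : tau (lift ord0 u) (lift ord0 v) P = P.
  rewrite rmorph_prod [RHS](reindex_inj (@perm_inj _ (tperm u v))).
  by apply: eq_bigr => j _; rewrite rmorphB y0fix tauz lift_tperm.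
have rowsE : \prod_(k < n.+1) \prod_(j < n.+2 | (k < j)%N) (y k - z j) =
    P * \prod_(k < n) \prod_(j < n.+1 | (k < j)%N) (y (lift ord0 k) - z' j).
  rewrite big_ord_recl; congr (_ * _).
    by rewrite big_mkcond big_ord_recl /= mul1r.
  apply: eq_bigr => k _; rewrite big_mkcond big_ord_recl /= mul1r.
  by rewrite [RHS]big_mkcond.
pose tau' u v := tau (lift ord0 u) (lift ord0 v).
have IH : L (T * \prod_(k < n.+1) \prod_(j < n.+2 | (k < j)%N) (y k - z j))
     *+ \prod_(k < n | ~~ b (lift ord0 k)) (n.+1 - k) = L (T * P * vdm z').
  rewrite rowsE mulrA.
  apply: (IHn z' tau' (y \o lift ord0) (b \o lift ord0) (T * P)).
  - by move=> u v j; rewrite /tau' /z' /= tauz lift_tperm.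
  - by move=> u v p uv; rewrite Ltau // (inj_eq lift_inj).
  - by move=> u v; rewrite rmorphM tauT Pfix.
  move=> k /=; move: (yP (lift ord0 k)); case: ifP => _.
    by move=> ->; congr z; apply: val_inj.
  case=> [[j jk ->] | yfix]; last by right=> u v; apply: yfix.
  have [-> | j0] := eqVneq j ord0.
    by right=> u v; rewrite tauz tpermD // -val_eqE.
  case: (unliftP ord0 j) j0 jk => [j' -> _ | ->]; last by rewrite eqxx.
  by move=> jk; left; exists j'.
have factE : (\prod_(k < n.+1 | ~~ b k) (n.+2 - k) = (if b ord0 then 1 else n.+2) *
    \prod_(k < n | ~~ b (lift ord0 k)) (n.+1 - k))%N.
  rewrite big_mkcond big_ord_recl -big_mkcond /= subn0.
  by case: (b _).
rewrite factE mulnC mulrnA IH; move: (yP ord0); case: ifP => /= _.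
  move=> y0; rewrite mulr1n -mulrA; congr (L (_ * _)).
  rewrite [RHS]vdm_recl.
  by congr (_ * _); apply: eq_bigr => j _; rewrite y0; congr (z _ - _); apply: val_inj.
case=> [[j //] | y0]; rewrite -mulrA.
apply: (@skew_replace_first _ _ L n.+1 z (tau ord0)) => //.
by move=> u p u0; rewrite Ltau // eq_sym.
Qed.

Definition swap_var (a b i : nat) : nat :=
  if i == a then b else if i == b then a else i.

Lemma swap_varK (a b : nat) : involutive (swap_var a b).
Proof.
move=> i; rewrite /swap_var; have [-> | ia] := eqVneq i a.
  by rewrite eqxx; case: eqVneq.
by have [-> | /negPf->] := eqVneq i b; rewrite ?eqxx ?(negPf ia).
Qed.

Definition swap_mon (a b : nat) (m : {cmonom nat}) : {cmonom nat} :=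
  [cmonom m (swap_var a b i) | i in (swap_var a b @` finsupp m)%fset]%M.

Lemma swap_monE (a b : nat) (m : {cmonom nat}) (i : nat) :
  swap_mon a b m i = m (swap_var a b i).
Proof.
rewrite cmE fsfun_fun; case: ifPn => // iN; apply/esym/eqP; rewrite cmE_eq0.
by apply: contra iN => im; rewrite -(swap_varK a b i) in_imfset.
Qed.

Lemma swap_monK (a b : nat) : involutive (swap_mon a b).
Proof. by move=> m; apply/eqP/cmP => i; rewrite !swap_monE swap_varK. Qed.

Definition swap_term (R : realType) (a b : nat) (m : {cmonom nat}) : polyInf R :=
  << swap_mon a b m >>.

Lemma malgU1M (R : realType) (m m' : {cmonom nat}) :
  (<< mmul m m' >> : polyInf R) = (<< m >> : polyInf R) * << m' >>.
Proof. by rewrite malgM_def fgmulUU mulr1. Qed.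

Lemma swap_term_morph (R : realType) (a b : nat) : mmorphism (swap_term R a b).
Proof.
split=> [m m'|]; last first.
  by congr << _ >>; apply/eqP/cmP => i; rewrite swap_monE !cm1.
rewrite /swap_term -malgU1M; congr << _ >>.
by apply/eqP/cmP => i; rewrite cmM !swap_monE cmM.
Qed.

HB.instance Definition _ (R : realType) (a b : nat) :=
  isMultiplicative.Build {cmonom nat} (polyInf R) (swap_term R a b)
    (swap_term_morph R a b).

(* Opaque, since unification loops when it unfolds [mmap]. *)
Lemma swap_poly_sig (R : realType) (a b : nat) :
  {f : {rmorphism polyInf R -> polyInf R}
     | forall p m, (f p)@_m = p@_(swap_mon a b m)}.
Proof.
exists (mmap (@malgC {cmonom nat} R) (swap_term R a b)) => p m.
rewrite /= mmapE raddf_sum /=.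
under eq_bigr do rewrite mcoeffCM mcoeffU (can2_eq (swap_monK a b) (swap_monK a b)).
rewrite [in RHS](monalgE p) raddf_sum /=; apply: eq_bigr => m' _.
by rewrite mcoeffU mulr_natr.
Qed.

Definition swap_poly (R : realType) (a b : nat) : {rmorphism polyInf R -> polyInf R} :=
  sval (swap_poly_sig R a b).

Lemma swap_polyE (R : realType) (a b : nat) (p : polyInf R) (m : {cmonom nat}) :
  (swap_poly R a b p)@_m = p@_(swap_mon a b m).
Proof. exact: (svalP (swap_poly_sig R a b)). Qed.

Lemma swap_poly_xvar (R : realType) (a b i : nat) :
  swap_poly R a b (xvar R i) = xvar R (swap_var a b i).
Proof.
apply/malgP => m; rewrite swap_polyE !mcoeffU.
rewrite -(can2_eq (swap_monK a b) (swap_monK a b)).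
congr (_ *+ (_ == _)); apply/eqP/cmP => j.
by rewrite swap_monE !cmU (can2_eq (swap_varK a b) (swap_varK a b)).
Qed.

Lemma inner_swap_poly (R : realType) (a b : nat) (p q : polyInf R) :
  inner (swap_poly R a b p) (swap_poly R a b q) = inner p q.
Proof.
rewrite (@inner_subset _ _ _ (swap_mon a b @` msupp p)%fset); last first.
  apply/fsubsetP => m; rewrite -mcoeff_neq0 swap_polyE mcoeff_neq0 => mp.
  by rewrite -(swap_monK a b m) in_imfset.
rewrite big_imfset; last by move=> m m' _ _; apply: (can_inj (swap_monK a b)).
by apply: eq_bigr => m _; rewrite (swap_polyE a b p) (swap_polyE a b q) swap_monK.
Qed.

Definition inner_left (R : realType) (q p : polyInf R) : R := inner p q.

Lemma inner_left_zmod (R : realType) (q : polyInf R) :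
  zmod_morphism (inner_left q).
Proof.
move=> p1 p2; rewrite /inner_left innerC addrC -scaleN1r inner_linearr mulN1r.
by rewrite addrC !(innerC q).
Qed.

HB.instance Definition _ (R : realType) (q : polyInf R) :=
  GRing.isZmodMorphism.Build (polyInf R) R (inner_left q) (inner_left_zmod q).

Lemma chinE (R : realType) (n : nat) : chin R n = vdm (fun j : 'I_n => xvar R j.+1).
Proof.
rewrite /chin big_add1 /= big_mkord; apply: eq_bigr => i _.
by rewrite big_add1 /= big_geq_mkord.
Qed.

Lemma swap_var_tperm (n : nat) (u v j : 'I_n) :
  swap_var u.+1 v.+1 j.+1 = (tperm u v j).+1.
Proof.
rewrite /swap_var !eqSS !val_eqE.
case: tpermP => [->|->|/eqP/negPf-> /eqP/negPf->] //; first by rewrite eqxx.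
by rewrite eqxx; case: eqVneq => // ->.
Qed.

Lemma swap_chin (R : realType) (n : nat) (u v : 'I_n) : u != v ->
  swap_poly R u.+1 v.+1 (chin R n) = - chin R n.
Proof.
move=> uv; rewrite chinE vdm_morph -mulN1r -[X in X * _]expr1.
have -> : 1%N = tperm u v by rewrite odd_tperm uv.
by rewrite -vdm_perm; apply: eq_vdm => j /=; rewrite swap_poly_xvar swap_var_tperm.
Qed.

Lemma inner_chin_swap (R : realType) (n : nat) (u v : 'I_n) (p : polyInf R) :
  u != v -> inner_left (chin R n) (swap_poly R u.+1 v.+1 p) = - inner_left (chin R n) p.
Proof.
move=> uv; rewrite -[in LHS](opprK (chin R n)) -(swap_chin R uv).
rewrite /inner_left innerC -[LHS]/(inner_left (swap_poly R _ _ p) (- _)) raddfN.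
by rewrite /= /inner_left inner_swap_poly innerC.
Qed.

Lemma inner_leftZ (R : realType) (q : polyInf R) (a : R) (p : polyInf R) :
  inner_left q (a *: p) = a * inner_left q p.
Proof.
by rewrite -[a *: p]addr0 /inner_left innerC inner_linearr innerC -/(inner_left q 0)
  -[inner q 0]innerC -/(inner_left q 0) raddf0 addr0.
Qed.

Lemma inner_left_sign (R : realType) (q : polyInf R) (e : nat) (p : polyInf R) :
  inner_left q ((-1) ^+ e * p) = (-1) ^+ e * inner_left q p.
Proof. by rewrite -inner_leftZ -[in LHS]signr_odd -[in RHS]signr_odd mulr_sign scaler_sign. Qed.

Lemma xvar_exp_monom (R : realType) (a e : nat) :
  exists2 m : {cmonom nat}, xvar R a ^+ e = << m >>
    & forall v, m v = ((a == v) * e)%N.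
Proof.
elim: e => [|e [m xE mE]]; first by exists mone => // v; rewrite cm1 muln0.
exists (mmul (ucm a) m) => [|v]; first by rewrite exprS xE malgU1M.
by rewrite cmM cmU mE mulnS.
Qed.

Lemma xvar_prod_monom (R : realType) (I : Type) (r : seq I) (f e : I -> nat) :
  exists2 m : {cmonom nat}, \prod_(i <- r) xvar R (f i) ^+ e i = << m >>
    & forall v, m v = (\sum_(i <- r) (f i == v) * e i)%N.
Proof.
elim: r => [|i r [m xE mE]]; first by exists mone => [|v]; rewrite big_nil ?cm1.
have [m' x'E m'E] := xvar_exp_monom R (f i) (e i).
exists (mmul m' m) => [|v]; first by rewrite big_cons xE x'E malgU1M.
by rewrite cmM m'E mE big_cons.
Qed.

Lemma inner_vdm_monom (R : realType) (n : nat) (s t : 'S_n) :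
  inner (\prod_i xvar R (s i).+1 ^+ i) (\prod_i xvar R (t i).+1 ^+ i) = (s == t)%:R.
Proof.
have [m sE mE] := xvar_prod_monom R (index_enum 'I_n) (fun i => (s i).+1) val.
have [m' tE m'E] := xvar_prod_monom R (index_enum 'I_n) (fun i => (t i).+1) val.
rewrite [X in inner X _]sE [X in inner _ X]tE inner_monom; congr _%:R.
have expE (w : 'S_n) (j : 'I_n) : (\sum_i ((w i).+1 == j.+1) * i)%N = (w^-1)%g j.
  rewrite (bigD1 (w^-1 j)%g) //= permKV eqxx mul1n big1 ?addn0 // => i.
  by rewrite eqSS val_eqE -(inj_eq (@perm_inj _ w)) permKV => /negPf->.
congr nat_of_bool; apply/idP/eqP => [/cmP mm' | st].
  apply: invg_inj; apply/permP => j; apply: val_inj => /=.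
  by rewrite -!expE -mE -m'E mm'.
by apply/cmP => v; rewrite mE m'E st.
Qed.

Lemma chin_expand (R : realType) (n : nat) :
  chin R n = \sum_(s : 'S_n) (-1) ^+ (s (+) odd (\sum_(i < n) i))
    *: \prod_i xvar R (s i).+1 ^+ i.
Proof.
rewrite chinE vdm_det /determinant; apply: eq_bigr => s _.
have -> : \prod_i Vandermonde n (\row_j - xvar R (nat_of_ord j).+1) i (s i) =
    (-1) ^+ (\sum_(i < n) i)%N * \prod_i xvar R (s i).+1 ^+ i.
  rewrite expr_sum -big_split; apply: eq_bigr => i _ /=.
  by rewrite 2!mxE -exprNn.
by rewrite -[_ ^+ \sum_(i < n) _]signr_odd mulrA -signr_addb mulr_sign scaler_sign.
Qed.

Lemma inner_orthonormal (R : realType) (I : finType) (M : I -> polyInf R)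
    (a : I -> R) :
  (forall s t, inner (M s) (M t) = (s == t)%:R) ->
  inner (\sum_s a s *: M s) (\sum_s a s *: M s) = \sum_s a s ^+ 2.
Proof.
move=> orthoM; have sumE q : inner (\sum_s a s *: M s) q = \sum_s a s * inner (M s) q.
  rewrite -[LHS]/(inner_left q _) raddf_sum.
  by apply: eq_bigr => s _; apply: inner_leftZ.
rewrite sumE; apply: eq_bigr => s _; rewrite innerC sumE (bigD1 s) //=.
rewrite orthoM eqxx mulr1 big1 ?addr0 // => t ts.
by rewrite orthoM (negPf ts) mulr0.
Qed.

Lemma inner_chin_self (R : realType) (n : nat) : inner (chin R n) (chin R n) = n`!%:R.
Proof.
rewrite chin_expand inner_orthonormal; last exact: inner_vdm_monom.
under eq_bigr do rewrite sqrr_sign.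
by rewrite sumr_const card_Sn.
Qed.

Lemma big_enum_finmem (A : comNzRingType) (I : finType) (P : pred I) (F : I -> A) :
  \prod_(u <- enum_finmem (mem [pred u | P u])) F u = \prod_(u | P u) F u.
Proof.
rewrite -[RHS]big_filter; apply/perm_big/uniq_perm.
- exact: enum_finmem_uniq.
- by rewrite filter_uniq // index_enum_uniq.
by move=> u; rewrite enum_finmemE.
Qed.

Lemma xvar_pos_pair (R : realType) (a : int) (b : nat) :
  xvar R (pos_pair a b).1 - xvar R (pos_pair a b).2 =
    (-1) ^+ (a <= 0)%R * (xvar R `|a| - xvar R b).
Proof.
rewrite /pos_pair; case: lerP => _ /=; last by rewrite expr0 mul1r.
by rewrite expr1 mulN1r opprB.
Qed.

Lemma pos_pair_inj (n : nat) (s : 'S_n.+1) (i : n.-tuple int) :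
  uniq i ->
  (forall k : 'I_n, exists2 j : 'I_n.+1, (j <= k)%N & `|tnth i k|%N = sval1 s j) ->
  {in [pred u : 'I_n * 'I_n.+1 | (u.1 < u.2)%N] &,
    injective (fun u => pos_pair (tnth i u.1) (sval1 s u.2))}.
Proof.
move=> hi his [k j] [k' j']; rewrite !inE /= => kj kj'.
have s_inj u v : sval1 s u = sval1 s v -> u = v.
  by case=> /val_inj /perm_inj.
have i_inj : injective (tnth i) by apply/tuple_uniqP.
(* A positive and a negative row cannot collide: [|i_l|] sits at a position of [s]
   that is at most [l] and equals [h' > l'], and symmetrically. *)
have mixed (l l' : 'I_n) (h h' : 'I_n.+1) : (l < h)%N -> (l' < h')%N ->
    `|tnth i l|%N = sval1 s h' -> sval1 s h = `|tnth i l'|%N -> False.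
  move=> lh lh' e e'; have [g gl eg] := his l; have [g' gl' eg'] := his l'.
  have gh : g = h' by apply: s_inj; rewrite -eg.
  have gh' : g' = h by apply: s_inj; rewrite -eg'.
  by subst g g'; lia.
rewrite /pos_pair; case: ltrP => ik; case: ltrP => ik' E;
  have /= e := congr1 fst E; have /= e' := congr1 snd E.
- by rewrite (s_inj _ _ e'); congr pair; apply: i_inj; lia.
- by case: (mixed k k' j j').
- by case: (mixed k' k j' j).
- by rewrite (s_inj _ _ e); congr pair; apply: i_inj; lia.
Qed.

Lemma chi_pattern (R : realType) (n : nat) (s : 'S_n.+1) (i : n.-tuple int) :
  uniq i ->
  (forall k : 'I_n, exists2 j : 'I_n.+1, (j <= k)%N & `|tnth i k|%N = sval1 s j) ->
  chi R (@pattern n.+1 s i) =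
    (-1) ^+ (\sum_(k < n | (tnth i k < 0)%R) (n.+1 - k.+1))%N
    * \prod_(k < n) \prod_(j < n.+1 | (k < j)%N)
        (xvar R `|tnth i k| - xvar R (sval1 s j)).
Proof.
move=> hi his.
have i0 k : tnth i k != 0 by have [j _ e] := his k; rewrite -absz_eq0 e.
rewrite /chi /pattern big_imfset; last exact: pos_pair_inj.
rewrite [LHS]big_enum_finmem.
under eq_bigr do rewrite xvar_pos_pair.
rewrite -(pair_big_dep xpredT (fun (k : 'I_n) (j : 'I_n.+1) => (k < j)%N)
  (fun k j => (-1) ^+ (tnth i k <= 0)%R
    * (xvar R `|tnth i k| - xvar R (sval1 s j)))) /=.
rewrite expr_sum [X in _ = X * _]big_mkcond -big_split; apply: eq_bigr => k _ /=.
rewrite big_split; congr (_ * _); rewrite prodr_const.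
have -> : #|[pred j : 'I_n.+1 | (k < j)%N]| = (n.+1 - k.+1)%N.
  rewrite -sum1_card -(big_geq_mkord k.+1 n.+1 xpredT (fun=> 1%N)).
  by rewrite sum_nat_const_nat muln1.
rewrite Order.POrderTheory.le_eqVlt (negPf (i0 k)) /=.
by case: ltrP => _; rewrite ?expr1 // expr0 expr1n.
Qed.

Lemma prod_descending_fact (n : nat) : (\prod_(k < n) (n.+1 - k))%N = n.+1`!.
Proof.
by rewrite -ffactnn ffactnSr subSn // subnn muln1 ffact_prod.
Qed.

Theorem theorem6p2 (R : realType) (n : nat) (hn : (1 <= n)%N) (s : 'S_n)
    (i : n.-1.-tuple int) (hi : uniq i)
    (his : forall k : 'I_n.-1,
       exists2 j : 'I_n, (j <= k)%N & `|tnth i k|%N = sval1 s j) :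
  inner (chi R (pattern s i)) (chin R n) =
    (-1) ^+ (\sum_(k < n.-1 | (tnth i k < 0)%R) (n - k.+1))%N
    * (-1) ^+ (odd_perm s)
    * \prod_(k < n.-1 | `|tnth i k|%N == sval1 s (widen_ord (leq_pred n) k))
        (n - k.+1 + 1)%N%:R.
Proof.
case: n => [//|n] in hn s i hi his *.
rewrite (chi_pattern R hi his) -/(inner_left _ _).
set d := (\sum_(k < n | _) _)%N; set P := \prod_(k < n) _.
rewrite inner_left_sign -mulrA; congr (_ * _).
pose b k := `|tnth i k|%N == sval1 s (widen_ord (leq_pred n.+1) k).
have rows := @skew_rows _ _ (inner_left (chin R n.+1)) n
  (fun j => xvar R (sval1 s j)) (fun u v => swap_poly R (sval1 s u) (sval1 s v))
  (fun k => xvar R `|tnth i k|) b 1.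
have {rows} rows : inner_left (chin R n.+1) P *+ \prod_(k < n | ~~ b k) (n.+1 - k)
    = (-1) ^+ s * n.+1`!%:R.
  rewrite -inner_chin_self -/(inner_left _ _) -inner_left_sign.
  have -> : (-1) ^+ s * chin R n.+1 = 1 * vdm (fun j => xvar R (sval1 s j)).
    by rewrite mul1r chinE -vdm_perm.
  rewrite -rows ?mul1r //.
  - move=> u v j; rewrite swap_poly_xvar swap_var_tperm.
    by rewrite -(inj_tperm _ _ _ (@perm_inj _ s)).
  - move=> u v p uv; apply: (@inner_chin_swap R n.+1 (s u) (s v)).
    by rewrite (inj_eq perm_inj).
  - by move=> u v; rewrite rmorph1.
  move=> k; case: ifPn => [/eqP -> | bk].
    by congr (xvar _ (sval1 s _)); apply: val_inj.
  left; have [j jk e] := his k; exists j; last by rewrite e.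
  rewrite ltn_neqAle jk andbT; apply: contra bk => /eqP jk'.
  by rewrite /b e; apply/eqP; congr sval1; apply: val_inj.
have C0 : (\prod_(k < n | ~~ b k) (n.+1 - k))%N%:R != 0 :> R.
  rewrite pnatr_eq0 -lt0n prodn_cond_gt0 // => k _.
  by rewrite subn_gt0 ltnS ltnW.
apply: (mulIf C0); rewrite mulr_natr rows -mulrA; congr (_ * _).
rewrite -natr_prod -natrM -prod_descending_fact (bigID b) /=; congr (_ * _)%N%:R.
by apply: eq_bigr => k _; rewrite addn1 subSS subSn // ltnW.
Qed.
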